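(* Let $\mathcal G$ be a $\Gamma$-periodic graph, $\Gamma\subset\mathbb R^d$ a lattice of rank $d$, with fundamental graph $G_*=(\mathcal V_*,\mathcal E_* )$. The invariant $\mathcal I=\frac12\,\#\operatorname{supp}\mathfrak m$ of $\mathcal G$, where $\mathfrak m\in\mathscr F(\kappa)$ is a minimal form on $G_*$, satisfies $$d\le\mathcal I\le\beta,\qquad \beta=\#\mathcal E_*-\#\mathcal V_*+1,$$ where $\beta$ is the Betti number of $G_*$. Moreover, i) there exists a periodic graph such that $d=\mathcal I=\beta$; ii) there exists a periodic graph such that $d=\mathcal I<\beta$; iii) there exists a periodic graph such that $d<\mathcal I=\beta$; iv) there exists a periodic graph such that $d<\mathcal I<\beta$; v) for any nonnegative integer $\mathrm n$ there exists a periodic graph such that $\beta-\mathcal I=\mathrm n$.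
   Context: Graphs may have loops and multiple edges. Each unoriented edge (including a loop) has two orientations, giving two oriented edges; $(u,v)$ denotes an oriented edge from $u$ to $v$, and $\underline{\mathbf e}$ the inverse of $\mathbf e$. A cycle is a closed path of oriented edges; the cycle space $\mathcal C$ of a finite connected graph is generated by its cycles (first homology group with integer coefficients). $\Gamma\subset\mathbb R^d$ is a lattice of rank $d$ with basis $\mathbb A=\{a_1,\ldots,a_d\}$. A $\Gamma$-periodic graph $\mathcal G=(\mathcal V,\mathcal E)$ is a connected infinite locally finite graph embedded in $\mathbb R^d$ (vertices are distinct points) with $\mathcal G+a=\mathcal G$ for all $a\in\Gamma$ and with finite quotient $G_*=\mathcal G/\Gamma=(\mathcal V_*,\mathcal E_* )$, called the fundamental graph; $\mathcal A$ and $\mathcal A_*=\mathcal A/\Gamma$ are the sets of oriented edges of $\mathcal G$ and $G_*$. For $x=\sum_st_sa_s$ put $x_{\mathbb A}=(t_1,\ldots,t_d)$. The coordinate form $\kappa:\mathcal A_*\to\mathbb R^d$ is $\kappa(\mathbf e_* )=v_{\mathbb A}-u_{\mathbb A}$ for any $\mathbf e=(u,v)\in\mathcal A$ in the class $\mathbf e_*$. A 1-form on a finite connected graph with oriented edge set $A$ is a map $\mathfrak b:A\to\mathbb R^d$ with $\mathfrak b(\underline{\mathbf e})=-\mathfrak b(\mathbf e)$; its flux function is $\Phi_{\mathfrak b}(\mathbf c)=\sum_{\mathbf e\in\mathbf c}\mathfrak b(\mathbf e)$, $\mathbf c\in\mathcal C$. $\mathscr F(\kappa)$ is the set of all 1-forms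 $\mathfrak b$ on $G_*$ with $\Phi_{\mathfrak b}=\Phi_{\kappa}$. A form $\mathfrak m\in\mathscr F(\kappa)$ is minimal if $\#\operatorname{supp}\mathfrak m\le\#\operatorname{supp}\mathfrak b$ for all $\mathfrak b\in\mathscr F(\kappa)$ (supports are subsets of $\mathcal A_*$). The number $\mathcal I$ depends only on the $\Gamma$-periodic graph $\mathcal G$. *)

(* Defs.v *)
From HB Require Import structures.
From mathcomp Require Import all_boot all_order all_algebra finmap.
From mathcomp Require Import mathcomp_extra boolp classical_sets functions.
From mathcomp Require Import cardinality reals.

Set Implicit Arguments.
Unset Strict Implicit.
Unset Printing Implicit Defensive.
Import Order.TTheory GRing.Theory Num.Theory.
Local Open Scope classical_set_scope.
Local Open Scope ring_scope.

Section Lattice.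
Context {R : realType} {d : nat}.

(* The basis vectors a_1, ..., a_d are the rows of B. *)
Definition lattice_basis (L : set 'rV[R]_d) (B : 'M[R]_d) : Prop :=
  B \in unitmx /\
  L = [set map_mx (fun k : int => k%:~R) n *m B | n in [set: 'rV[int]_d]].

Definition is_lattice (L : set 'rV[R]_d) : Prop :=
  exists B, lattice_basis L B.

(* The row t with x = \sum_s t_s a_s. *)
Definition coords (B : 'M[R]_d) (x : 'rV[R]_d) : 'rV[R]_d := x *m invmx B.

Lemma lattice0 L : is_lattice L -> L 0.
Proof.
move=> [B [_ ->]]; exists 0 => //.
by rewrite (_ : map_mx _ 0 = 0) ?mul0mx //; apply/rowP => i; rewrite !mxE.
Qed.

Lemma latticeB L u v : is_lattice L -> L u -> L v -> L (u - v).
Proof.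
move=> [B [_ ->]] [m _ <-] [n _ <-]; exists (m - n) => //.
rewrite -mulmxBl; congr (_ *m _).
by apply/rowP => i; rewrite !mxE rmorphB.
Qed.

Lemma latticeN L u : is_lattice L -> L u -> L (- u).
Proof. by move=> hL Lu; rewrite -sub0r; apply: latticeB => //; exact: lattice0. Qed.

Lemma latticeD L u v : is_lattice L -> L u -> L v -> L (u + v).
Proof.
by move=> hL Lu Lv; rewrite -[v]opprK; apply: latticeB => //; exact: latticeN.
Qed.

End Lattice.

(* Graphs with vertices in R^d, loops and multiple edges allowed.  Edges are
   abstract, so that parallel edges can be told apart.  Each edge, loops
   included, is a pair {e, erev e} of two distinct oriented edges. *)
Record egraph (R : realType) (d : nat) := EGraph {
  vert : set 'rV[R]_d;
  arc : Type;
  src : arc -> 'rV[R]_d;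
  erev : arc -> arc;
  src_vert : forall e, vert (src e);
  erevK : involutive erev;
  erev_neq : forall e, erev e <> e }.

Definition tgt {R : realType} {d : nat} (G : egraph R d) (e : arc G) :=
  src (erev e).

Fixpoint walk {R : realType} {d : nat} (G : egraph R d)
    (u : 'rV[R]_d) (p : seq (arc G)) (v : 'rV[R]_d) : Prop :=
  if p is e :: q then src e = u /\ walk (tgt e) q v else u = v.

Definition connected_graph {R : realType} {d : nat} (G : egraph R d) : Prop :=
  forall u v, vert G u -> vert G v -> exists p : seq (arc G), walk u p v.

Definition locally_finite_graph {R : realType} {d : nat} (G : egraph R d) : Prop :=
  forall v, vert G v -> finite_set [set e : arc G | src e = v].

(* [trans a] is the translation of oriented edges by a; only its values for
   a in [lat] matter.  Oriented edges being abstract, the invariance G + a = G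
   is an action of [lat] on them, compatible with the translation of vertices
   and with the reversal of orientation. *)
Record periodic_graph (R : realType) (d : nat) := PeriodicGraph {
  pgraph :> egraph R d;
  lat : set 'rV[R]_d;
  latP : is_lattice lat;
  trans : 'rV[R]_d -> arc pgraph -> arc pgraph;
  vert_trans : forall a v, lat a -> vert pgraph v -> vert pgraph (v + a);
  trans0 : forall e, trans 0 e = e;
  transD : forall a b e, lat a -> lat b ->
    trans (a + b) e = trans a (trans b e);
  src_trans : forall a e, lat a -> src (trans a e) = src e + a;
  erev_trans : forall a e, lat a -> erev (trans a e) = trans a (erev e);
  pg_connected : connected_graph pgraph;
  pg_infinite : infinite_set (vert pgraph);
  pg_locally_finite : locally_finite_graph pgraph;
  vert_quot_finite :
    finite_set [set [set v + a | a in lat] | v in vert pgraph];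
  arc_quot_finite :
    finite_set [set [set trans a e | a in lat] | e in [set: arc pgraph]] }.

Record fin_graph := FinGraph {
  fvert : finType;
  farc : finType;
  fsrc : farc -> fvert;
  frev : farc -> farc;
  frevK : involutive frev;
  frev_neq : forall e, frev e != e }.

Definition ftgt (H : fin_graph) (e : farc H) := fsrc (frev e).

Definition fedges (H : fin_graph) : {set {set farc H}} :=
  [set [set e; frev e]%SET | e : farc H]%SET.

Definition betti (H : fin_graph) : int := #|fedges H|%:Z - #|fvert H|%:Z + 1.

Section FundamentalGraph.
Context {R : realType} {d : nat} (G : periodic_graph R d).

Definition vorbit (v : 'rV[R]_d) : set 'rV[R]_d := [set v + a | a in lat G].
Definition aorbit (e : arc G) : set (arc G) := [set trans a e | a in lat G].

Definition qvert : finType := fset_set (vorbit @` vert G).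
Definition qarc : finType := fset_set (aorbit @` [set: arc G]).

Lemma vproj_subproof v : vert G v -> vorbit v \in fset_set (vorbit @` vert G).
Proof.
move=> Vv; rewrite in_fset_set; last exact: vert_quot_finite.
by rewrite inE; exists v.
Qed.

Lemma aproj_subproof e : aorbit e \in fset_set (aorbit @` [set: arc G]).
Proof.
rewrite in_fset_set; last exact: arc_quot_finite.
by rewrite inE; exists e.
Qed.

Definition vproj v (Vv : vert G v) : qvert := FSetSub (vproj_subproof Vv).
Definition aproj e : qarc := FSetSub (aproj_subproof e).

Lemma aproj_surj (x : qarc) : exists e, aproj e = x.
Proof.
case: x => s sP; have := sP; rewrite in_fset_set; last exact: arc_quot_finite.
by rewrite inE => -[e _ es]; exists e; apply: val_inj.
Qed.

Lemma vproj_surj (x : qvert) : exists v (Vv : vert G v), vproj Vv = x.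
Proof.
case: x => s sP; have := sP; rewrite in_fset_set; last exact: vert_quot_finite.
by rewrite inE => -[v Vv vs]; exists v, Vv; apply: val_inj.
Qed.

Lemma vproj_eqP u v (Vu : vert G u) (Vv : vert G v) :
  vproj Vu = vproj Vv <-> lat G (v - u).
Proof.
have hL := latP G; split.
- move=> /(congr1 val) /= E.
  have : vorbit v v by exists 0; [exact: lattice0 | rewrite addr0].
  by rewrite -E => -[a La <-]; rewrite addrC addKr.
move=> Luv; apply: val_inj => /=; apply/seteqP; split => _ [a La <-].
- exists (a - (v - u)); first exact: latticeB.
  by rewrite opprB addrCA subrKC addrC.
- exists (a + (v - u)); first exact: latticeD.
  by rewrite addrCA subrKC addrC.
Qed.

Lemma aproj_eqP e f : aproj e = aproj f <-> exists2 a, lat G a & f = trans a e.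
Proof.
have hL := latP G; split.
- move=> /(congr1 val) /= E.
  have : aorbit f f by exists 0; [exact: lattice0 | exact: trans0].
  by rewrite -E => -[a La <-]; exists a.
move=> [b Lb ->]; apply: val_inj => /=; apply/seteqP; split => _ [a La <-].
- exists (a - b); first exact: latticeB.
  by rewrite -transD ?subrK//; exact: latticeB.
- by exists (a + b); [exact: latticeD | rewrite transD].
Qed.

Definition arepr (x : qarc) : arc G := projT1 (cid (aproj_surj x)).

Lemma areprK x : aproj (arepr x) = x.
Proof. by rewrite /arepr; case: cid. Qed.

Lemma arepr_aproj e : exists2 a, lat G a & arepr (aproj e) = trans a e.
Proof. by apply/aproj_eqP; rewrite areprK. Qed.

Definition qsrc (x : qarc) : qvert := vproj (src_vert (arepr x)).
Definition qrev (x : qarc) : qarc := aproj (erev (arepr x)).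

Lemma qsrc_aproj e : qsrc (aproj e) = vproj (src_vert e).
Proof.
apply/vproj_eqP; have [a La ->] := arepr_aproj e.
by rewrite src_trans// opprD addNKr; exact: latticeN (latP G) La.
Qed.

Lemma qrev_aproj e : qrev (aproj e) = aproj (erev e).
Proof.
apply/esym/aproj_eqP; have [a La ->] := arepr_aproj e.
by exists a => //; rewrite erev_trans.
Qed.

Lemma qrevK : involutive qrev.
Proof. by move=> x; rewrite -(areprK x) !qrev_aproj erevK. Qed.

Lemma qrev_neq x : qrev x != x.
Proof.
apply/eqP; rewrite -(areprK x) qrev_aproj; move: (arepr x) => e.
move=> /esym /aproj_eqP [a La re].
have rre : erev (trans a e) = e by rewrite -re erevK.
have a20 : a + a = 0.
  have := congr1 (@src _ _ G) rre.
  rewrite erev_trans// src_trans// re src_trans// -addrA.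
  by rewrite -[RHS]addr0 => /addrI.
have a0 : a = 0.
  apply/rowP => i; have := congr1 (fun w : 'rV[R]_d => w 0 i) a20.
  by rewrite !mxE -mulr2n => /eqP; rewrite mulrn_eq0 => /eqP.
by move: re; rewrite a0 trans0; exact: erev_neq.
Qed.

Definition fundamental_graph : fin_graph := FinGraph qsrc qrevK qrev_neq.

Definition kappa (B : 'M[R]_d) (x : farc fundamental_graph) : 'rV[R]_d :=
  coords B (tgt (arepr x)) - coords B (src (arepr x)).

Lemma kappaE (B : 'M[R]_d) (e : arc G) :
  kappa B (aproj e) = coords B (tgt e) - coords B (src e).
Proof.
rewrite /kappa; have [a La ->] := arepr_aproj e.
rewrite /tgt erev_trans// !src_trans// /coords -!mulmxBl.
by rewrite opprD addrACA subrr addr0.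
Qed.

End FundamentalGraph.

Section Forms.
Context {R : realType} {d : nat} (H : fin_graph).
Implicit Type b : farc H -> 'rV[R]_d.

Definition one_form b : Prop := forall e, b (frev e) = - b e.

Definition supp b : {set farc H} := [set e | b e != 0]%SET.

Definition is_cycle (p : seq (farc H)) : bool :=
  cycle (fun e f => ftgt e == fsrc f) p.

(* Integer 1-chains are the antisymmetric functions c : farc H -> int; the
   oriented edge e stands for the chain that is 1 at e and -1 at frev e. *)
Definition chain (p : seq (farc H)) : {ffun farc H -> int} :=
  [ffun e => (count_mem e p)%:Z - (count_mem (frev e) p)%:Z].

Inductive cycle_space : {ffun farc H -> int} -> Prop :=
| cycle_space_cycle p : is_cycle p -> cycle_space (chain p)
| cycle_space0 : cycle_space 0
| cycle_spaceB c1 c2 : cycle_space c1 -> cycle_space c2 ->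
    cycle_space (c1 - c2).

(* Both orientations of each edge contribute the same term, hence the factor
   1/2; on a cycle this is the sum of b over its edges (flux_chain). *)
Definition flux b (c : {ffun farc H -> int}) : 'rV[R]_d :=
  2^-1 *: \sum_(e : farc H) b e *~ c e.

Lemma flux_chain b p : one_form b -> flux b (chain p) = \sum_(e <- p) b e.
Proof.
move=> hb.
have count_sum (g : farc H -> 'rV[R]_d) :
    \sum_e g e *~ (count_mem e p)%:Z = \sum_(e <- p) g e.
  elim: p => [|f p IH] /=; first by rewrite big_nil big1// => e _; rewrite mulr0z.
  rewrite big_cons -IH (bigD1 f)//= [in RHS](bigD1 f)//= eqxx addrA.
  rewrite PoszD mulrzDr mulr1z; congr (_ + _).
  by apply: eq_bigr => e /negPf ef; rewrite eq_sym ef.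
rewrite /flux.
have -> : \sum_e b e *~ chain p e = (\sum_(e <- p) b e) *+ 2.
  under eq_bigr => e _ do rewrite ffunE mulrzBr.
  rewrite sumrB count_sum mulr2n; congr (_ + _).
  rewrite (reindex_inj (inv_inj (@frevK H))) /=.
  under eq_bigr => e _ do rewrite frevK hb mulNrz.
  by rewrite sumrN opprK count_sum.
by rewrite -scaler_nat scalerA mulVf ?scale1r// pnatr_eq0.
Qed.

End Forms.

Section Invariant.
Context {R : realType} {d : nat} (G : periodic_graph R d).
Local Notation form := (farc (fundamental_graph G) -> 'rV[R]_d).

Definition flux_class (B : 'M[R]_d) (b : form) : Prop :=
  one_form b /\ forall c, cycle_space c -> flux b c = flux (kappa B) c.

Definition minimal_form (B : 'M[R]_d) (m : form) : Prop :=
  flux_class B m /\ forall b, flux_class B b -> (#|supp m| <= #|supp b|)%N.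

Lemma kappa_one_form (B : 'M[R]_d) : one_form (kappa (G := G) B).
Proof.
move=> x; rewrite -(areprK x) /= qrev_aproj !kappaE /tgt erevK.
by rewrite opprB.
Qed.

Lemma minimal_form_exists (B : 'M[R]_d) : exists m, minimal_form B m.
Proof.
pose P n := `[< exists2 b, flux_class B b & #|supp b| = n >].
have exP : exists n, P n.
  exists #|supp (kappa (G := G) B)|; apply/asboolP.
  by exists (kappa B) => //; split=> //; exact: kappa_one_form.
case: (ex_minnP exP) => n /asboolP [m mF <-] mmin.
by exists m; split=> // b bF; apply: mmin; apply/asboolP; exists b.
Qed.

(* Computed from an arbitrary basis of the lattice and an arbitrary minimal
   form; the value does not depend on these choices. *)
Definition periodic_invariant : rat :=
  let B := projT1 (cid (latP G)) in
  #|supp (projT1 (cid (minimal_form_exists B)))|%:R / 2.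

End Invariant.

(* Main.v *)
Require Import Defs.
From HB Require Import structures.
From mathcomp Require Import all_boot all_order all_algebra finmap.
From mathcomp Require Import mathcomp_extra boolp classical_sets functions.
From mathcomp Require Import cardinality reals.

From mathcomp Require Import zify.

Set Implicit Arguments.
Unset Strict Implicit.
Unset Printing Implicit Defensive.
Import Order.TTheory GRing.Theory Num.Theory.
Local Open Scope ring_scope.

(** Why the theorem holds.

    Lower bound.  For a basis vector a_s of the lattice, a walk in the periodic
    graph from a vertex v to v + a_s projects to a cycle of the fundamental
    graph whose flux under kappa is the s-th unit vector.  Every form b with
    the same fluxes therefore has values that span R^d.  Since b changes sign
    under reversal, this span is already generated by one orientation of each
    edge in the support, so d is at most half the size of the support
    ([card_supp_ge], [flux_class_supp_ge]).

    Upper bound.  Coboundaries of vertex potentials have zero flux.  Summing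
    kappa along the paths of a spanning tree gives a potential f for which
    kappa - df vanishes on the #V - 1 edges of the tree, hence has at most
    #E - #V + 1 edges in its support ([potential_on_tree],
    [exists_small_cohomologous]).

    Independence of the basis.  The coordinate forms of two bases differ by
    right multiplication by an invertible matrix, which acts on forms without
    changing their supports ([flux_class_change_basis]).

    Examples.  When the fundamental graph has a single vertex, every oriented
    edge is itself a cycle, so kappa is the only form with its fluxes and the
    invariant can be read off kappa ([periodic_invariant_bouquet]).  Take the
    integer points of the line with k + 1 parallel edges from each m to m + 1
    and n loops at each m: here d = 1, the invariant is k + 1 and the Betti
    number is k + 1 + n ([exists_periodic_graph]).  Suitable k and n give
    every case. *)

(** * One-forms on finite graphs *)

Section FiniteGraph.
Context {R : realType} {d : nat} (H : fin_graph).
Implicit Types (b : farc H -> 'rV[R]_d) (f : fvert H -> 'rV[R]_d).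

(** Picks one of the two orientations of each edge; any linear order on the
    oriented edges would serve, and enumeration ranks provide one. *)
Definition orientation : {set farc H} :=
  [set e | (enum_rank e < enum_rank (frev e))%N]%SET.

Lemma orientation_frev e : (frev e \in orientation) = (e \notin orientation).
Proof.
rewrite !inE frevK -leqNgt ltn_neqAle andb_idl// => _.
by apply: contra_neq (frev_neq e) => /val_inj/enum_rank_inj.
Qed.

Lemma card_frev_closed (S : {set farc H}) :
  (forall e, (frev e \in S) = (e \in S)) ->
  #|S| = (#|S :&: orientation| * 2)%N.
Proof.
move=> hS; rewrite -(cardsID orientation S) muln2 -addnn; congr (_ + _)%N.
rewrite -(card_imset _ (inv_inj (@frevK H))); apply: eq_card => e.
apply/imsetP/idP => [[x xS ->]|].
  by move: xS; rewrite finset.in_setD finset.in_setI hS orientation_frev andbC.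
rewrite !finset.in_setI => /andP[eS eO]; exists (frev e); last by rewrite frevK.
by rewrite finset.in_setD hS eS orientation_frev eO.
Qed.

Lemma card_farc : #|farc H| = (#|fedges H| * 2)%N.
Proof.
rewrite -cardsT card_frev_closed ?finset.setTI; last by move=> e; rewrite !inE.
congr (_ * _)%N; rewrite -(card_in_imset (f := fun e => [set e; frev e]%SET)).
  apply: eq_card => s; apply/imsetP/imsetP => [[e _ ->]|[e _ ->]]; first by exists e.
  have [eO|eO] := boolP (e \in orientation); first by exists e.
  by exists (frev e); rewrite ?orientation_frev// frevK finset.setUC.
move=> e g eO gO /setP/(_ e); rewrite !inE eqxx => /esym/orP[/eqP//|/eqP eg].
by move: eO; rewrite eg orientation_frev gO.
Qed.

Lemma supp_frev b : one_form b -> forall e, (frev e \in supp b) = (e \in supp b).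
Proof. by move=> hb e; rewrite !inE hb oppr_eq0. Qed.

(** The values of b on the oriented edges of its support that belong to
    [orientation] span all values of b, the others being their opposites; so
    the span of all sums of values has dimension at most half the size of the
    support. *)
Lemma card_supp_ge b : one_form b ->
  (forall i : 'I_d, exists p : seq (farc H), \sum_(e <- p) b e = delta_mx 0 i) ->
  (d * 2 <= #|supp b|)%N.
Proof.
move=> hb hspan; rewrite (card_frev_closed (supp_frev hb)) leq_mul2r /=.
set A := _ :&: _; pose U := (\sum_(e in A) <<b e>>)%MS.
have bU e : (b e <= U)%MS.
  have [->|b0] := eqVneq (b e) 0; first exact: sub0mx.
  have eS : e \in supp b by rewrite inE.
  have [eO|eO] := boolP (e \in orientation).
    by apply: (sumsmx_sup e); rewrite ?genmxE// finset.in_setI eS.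
  rewrite -(frevK e) hb eqmx_opp; apply: (sumsmx_sup (frev e)); rewrite ?genmxE//.
  by rewrite finset.in_setI supp_frev// eS orientation_frev.
have fullU : (1%:M <= U)%MS.
  apply/row_subP => i; have [p] := hspan i; rewrite row1 => <-.
  by elim/big_ind: _ => // [|x y]; [exact: sub0mx|exact: addmx_sub].
have := mxrankS fullU; rewrite mxrank1 => /leq_trans; apply.
rewrite -sum1_card /U; elim/big_rec2: _ => [|e n V _ IH]; first by rewrite mxrank0.
apply: leq_trans (mxrank_adds_leqif _ _) (leq_add _ IH).
by rewrite mxrank_gen rank_leq_row.
Qed.

Definition coboundary f (e : farc H) : 'rV[R]_d := f (ftgt e) - f (fsrc e).

Lemma coboundary_one_form f : one_form (coboundary f).
Proof. by move=> e; rewrite /coboundary /ftgt frevK opprB. Qed.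

Lemma sum_coboundary_cycle f p :
  is_cycle p -> \sum_(e <- p) coboundary f e = 0.
Proof.
case: p => [|e p]; first by rewrite big_nil.
have telescope h q : path (fun x y => ftgt x == fsrc y) h q ->
    \sum_(x <- q) coboundary f x = f (ftgt (last h q)) - f (ftgt h).
  elim: q h => [|g q IH] h /=; first by rewrite big_nil subrr.
  case/andP=> /eqP hg /IH; rewrite big_cons => ->.
  by rewrite /coboundary hg addrC subrKA.
rewrite /is_cycle /= => /telescope.
by rewrite last_rcons subrr (perm_big _ (permEl (perm_rcons e p))).
Qed.

Lemma flux_coboundary f c : cycle_space c -> flux (coboundary f) c = 0.
Proof.
elim=> [p hp||c1 c2 _ h1 _ h2].
- by rewrite flux_chain ?sum_coboundary_cycle//; exact: coboundary_one_form.
- by rewrite /flux big1 ?scaler0// => e _; rewrite ffunE mulr0z.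
- rewrite -[RHS]subr0 -{1}h1 -{1}h2 /flux -scalerBr -sumrB.
  by congr (_ *: _); apply: eq_bigr => e _; rewrite !ffunE mulrzBr.
Qed.

Lemma flux_sub_coboundary b f c : cycle_space c ->
  flux (fun e => b e - coboundary f e) c = flux b c.
Proof.
move=> hc; rewrite -[RHS]subr0 -(flux_coboundary f hc) /flux -scalerBr -sumrB.
by congr (_ *: _); apply: eq_bigr => e _; rewrite mulrzBl.
Qed.

(** Connectedness in terms of cuts: this is the form in which a spanning tree
    is grown. *)
Definition fin_connected : Prop :=
  (0 < #|fvert H|)%N /\
  forall S : {set fvert H}, S != finset.set0 -> S != [set: fvert H]%SET ->
    exists e, (fsrc e \in S) && (ftgt e \notin S).

(** A tree grown one edge at a time: an edge e that leaves S determines the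
    value of the potential at its new endpoint, and both e and its reverse are
    added to the set where b is the coboundary of the potential.  The tree
    edges lie inside S, where later changes of the potential, made at vertices
    outside S, do not affect them. *)
Lemma potential_on_tree b : one_form b -> fin_connected -> forall k,
  (k < #|fvert H|)%N -> exists (S : {set fvert H}) f, #|S| = k.+1 /\
    (k * 2 <= #|[set e | [&& fsrc e \in S, ftgt e \in S
                          & b e == coboundary f e]]|)%N.
Proof.
move=> hb [H0 hH]; elim=> [_|k IH kH].
  by have /card_gt0P[v _] := H0; exists [set v], (fun=> 0); rewrite cards1 mul0n.
have [S [f [cS cE]]] := IH (ltnW kH).
have [||e /andP[es et]] := hH S.
- by rewrite -card_gt0 cS.
- by apply: contraTneq kH => ST; rewrite -cS ST cardsT ltnn.
pose f' v := if v == ftgt e then f (fsrc e) + b e else f v.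
have f'S v : v \in S -> f' v = f v.
  by rewrite /f'; case: eqP => // ->; rewrite (negPf et).
have f't : f' (ftgt e) = f (fsrc e) + b e by rewrite /f' eqxx.
exists (ftgt e |: S), f'; split; first by rewrite cardsU1 et cS.
set E := [set x | _] in cE; set E' := [set x | _].
have eE : e \notin E by rewrite inE es (negPf et).
have reE : frev e \notin e |: E.
  by rewrite finset.in_setU1 (negPf (frev_neq e)) inE -/(ftgt e) (negPf et).
apply: leq_trans (_ : #|frev e |: (e |: E)| <= _)%N.
  by rewrite cardsU1 reE cardsU1 eE mulSn.
have eE' : e \in E'.
  by rewrite inE !finset.in_setU1 es eqxx orbT /= /coboundary f't f'S// addrC addKr.
rewrite subset_leq_card//; apply/fintype.subsetP => x.
rewrite 2!finset.in_setU1 => /or3P[/eqP->|/eqP->//|].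
  move: eE'; rewrite !inE hb coboundary_one_form eqr_opp.
  rewrite [ftgt (frev e)](congr1 (@fsrc H) (frevK e)).
  by case/and3P=> es' et' ->; rewrite andbT; apply/andP.
rewrite !inE => /and3P[xs xt /eqP ->].
by rewrite xs xt !orbT /coboundary !f'S /=.
Qed.

(** Subtracting the coboundary of a potential adapted to a spanning tree keeps
    all fluxes and kills the form on the tree. *)
Lemma exists_small_cohomologous b : one_form b -> fin_connected ->
  exists2 g, one_form g & (forall c, cycle_space c -> flux g c = flux b c) /\
    #|supp g|%:Z <= betti H * 2.
Proof.
move=> hb hH; have H0 := hH.1.
have [|S [f [_ cE]]] := potential_on_tree hb hH (k := #|fvert H|.-1).
  by rewrite prednK.
exists (fun e => b e - coboundary f e).
  by move=> e; rewrite hb coboundary_one_form -opprD.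
split; first by move=> c; exact: flux_sub_coboundary.
set E := [set e | _] in cE.
have : (#|supp (fun e => (b e - coboundary f e)%R)| + #|E| <= #|farc H|)%N.
  rewrite -(cardsC E) addnC leq_add2l subset_leq_card//.
  apply/fintype.subsetP => e; rewrite !inE subr_eq0; apply: contra.
  by case/and3P.
rewrite card_farc /betti; move: H0 cE; lia.
Qed.

End FiniteGraph.

(** * Bounds on the invariant *)

Section Fundamental.
Context {R : realType} {d : nat} (G : periodic_graph R d).
Local Notation H := (fundamental_graph G).

Lemma ftgt_aproj (e : Defs.arc G) :
  ftgt (aproj e : farc H) = vproj (src_vert (erev e)).
Proof. by rewrite /ftgt /= qrev_aproj qsrc_aproj. Qed.

Lemma vert_nonempty : exists v, vert G v.
Proof. exact: infinite_setN0 (@pg_infinite _ _ G). Qed.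

Lemma vproj_eq u v (Vu : vert G u) (Vv : vert G v) :
  u = v -> vproj Vu = vproj Vv :> fvert H.
Proof.
by move=> uv; apply/(vproj_eqP Vu Vv); rewrite uv subrr; exact: lattice0 (latP G).
Qed.

(** A walk in the periodic graph from a vertex over S to a vertex outside S
    has a first edge whose projection leaves S. *)
Lemma fundamental_connected : fin_connected H.
Proof.
split; first by have [v Vv] := vert_nonempty; apply/card_gt0P; exists (vproj Vv).
move=> S /set0Pn[x xS] /eqP ST.
have [y yS] : exists y, y \notin S.
  apply/existsP; rewrite -negb_forall; apply/negP => /forallP h.
  by apply: ST; apply/setP => y; rewrite inE h.
have [u [Vu ux]] := vproj_surj x; have [v [Vv vy]] := vproj_surj y.
have [p] := pg_connected Vu Vv.
move: xS yS; rewrite -ux -vy; clear x ux y vy.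
elim: p u Vu => [|e p IH] u Vu uS vS /=.
  by move=> uv; rewrite (vproj_eq Vv Vu (esym uv)) uS in vS.
move=> [eu ep]; have eS : fsrc (aproj e : farc H) \in S.
  by rewrite /= qsrc_aproj (vproj_eq _ Vu eu).
have [tS|tS] := boolP (ftgt (aproj e : farc H) \in S); last first.
  by exists (aproj e); rewrite eS tS.
by rewrite ftgt_aproj in tS; exact: IH tS vS ep.
Qed.

Lemma is_cycle_walk u a (p : seq (Defs.arc G)) :
  lat G a -> walk u p (u + a) -> is_cycle (map (aproj (G := G)) p : seq (farc H)).
Proof.
move=> La; case: p => // e p [eu ep].
have path_walk h q v : walk (tgt h) q v ->
    path (fun x y : farc H => ftgt x == fsrc y) (aproj h) (map (aproj (G := G)) q)
    /\ tgt (last h q) = v.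
  elim: q h => [//|g q IH] h /= [gh /IH [-> ->]]; split=> //; rewrite andbT.
  by apply/eqP; rewrite qrev_aproj !qsrc_aproj; exact/vproj_eq/esym.
have [pathp lastp] := path_walk _ _ _ ep.
rewrite /is_cycle /= rcons_path pathp last_map qrev_aproj !qsrc_aproj /=.
apply/eqP/vproj_eqP; rewrite eu -/(tgt _) lastp opprD addNKr.
exact: latticeN (latP G) La.
Qed.

Lemma sum_kappa_walk B u v (p : seq (Defs.arc G)) : walk u p v ->
  \sum_(x <- map (aproj (G := G)) p) kappa B x = coords B v - coords B u.
Proof.
elim: p u => [|e p IH] u /=; first by move=> ->; rewrite big_nil subrr.
by move=> [<- /IH]; rewrite big_cons kappaE => ->; rewrite addrC subrKA.
Qed.

(** A walk from v to its translate by the i-th basis vector projects to a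
    cycle whose flux is the i-th unit vector. *)
Lemma flux_class_supp_ge B (b : farc H -> 'rV[R]_d) :
  lattice_basis (lat G) B -> flux_class B b -> (d * 2 <= #|supp b|)%N.
Proof.
move=> [Bu BL] [hb bF]; apply: card_supp_ge => // i.
have [v Vv] := vert_nonempty.
have Li : lat G (row i B).
  rewrite BL; exists (delta_mx 0 i) => //; rewrite rowE; congr (_ *m _).
  by apply/rowP => j; rewrite !mxE; case: (_ && _).
have [p hp] := pg_connected Vv (vert_trans Li Vv).
exists (map (aproj (G := G)) p).
have hc := is_cycle_walk Li hp.
rewrite -flux_chain// bF; last exact: cycle_space_cycle.
rewrite flux_chain; last exact: kappa_one_form.
rewrite (sum_kappa_walk _ hp) /coords mulmxDl addrC addKr.
by rewrite -row_mul mulmxV// row1.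
Qed.

Lemma minimal_form_supp_le B (m : farc H -> 'rV[R]_d) :
  minimal_form B m -> #|supp m|%:Z <= betti H * 2.
Proof.
move=> [_ mmin].
have [g g1 [gF gb]] :=
  exists_small_cohomologous (kappa_one_form B) fundamental_connected.
by apply: le_trans gb; rewrite lez_nat; apply: mmin.
Qed.

(** The coordinate forms are related by kappa B' = kappa B *m C with
    C = B *m invmx B' invertible, so multiplication by C carries one flux class
    to the other, and b e *m C vanishes only when b e does. *)
Lemma flux_class_change_basis B B' (b : farc H -> 'rV[R]_d) :
  B \in unitmx -> B' \in unitmx -> flux_class B b ->
  exists2 b' : farc H -> 'rV[R]_d, flux_class B' b' & #|supp b'| = #|supp b|.
Proof.
move=> Bu B'u [hb bF]; pose C := B *m invmx B'.
have Cu : C \in unitmx by rewrite unitmx_mul Bu unitmx_inv.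
have fluxC (g : farc H -> 'rV[R]_d) c : flux (fun e => g e *m C) c = flux g c *m C.
  rewrite /flux -scalemxAl mulmx_suml; congr (_ *: _).
  by apply: eq_bigr => e _; rewrite -!scaler_int scalemxAl.
exists (fun e => b e *m C).
  split=> [e|c hc]; first by rewrite hb mulNmx.
  rewrite fluxC bF// -fluxC; congr flux; apply/funext => e.
  by rewrite /kappa /coords mulmxBl -!mulmxA !(mulKmx Bu).
apply: eq_card => e; rewrite !inE; congr (~~ _).
by apply/eqP/eqP => [h|->]; [rewrite -(mulmxK Cu (b e)) h|]; rewrite mul0mx.
Qed.

Lemma card_supp_minimal B B' (m m' : farc H -> 'rV[R]_d) :
  B \in unitmx -> B' \in unitmx ->
  minimal_form B m -> minimal_form B' m' -> #|supp m| = #|supp m'|.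
Proof.
move=> Bu B'u [mF mmin] [m'F m'min]; apply/eqP; rewrite eqn_leq.
have [g gF gm'] := flux_class_change_basis B'u Bu m'F.
have [g' g'F g'm] := flux_class_change_basis Bu B'u mF.
by apply/andP; split; [rewrite -gm'; exact: mmin | rewrite -g'm; exact: m'min].
Qed.

Lemma periodic_invariantE B (m : farc H -> 'rV[R]_d) :
  B \in unitmx -> minimal_form B m -> periodic_invariant G = #|supp m|%:R / 2.
Proof.
move=> Bu hm; rewrite /periodic_invariant.
case: (cid (latP G)) => B' [B'u _] /=; case: cid => m' hm' /=.
by rewrite (card_supp_minimal Bu B'u hm hm').
Qed.

Lemma periodic_invariant_bounds :
  d%:R <= periodic_invariant G <= (betti H)%:~R.
Proof.
have [B BL] := latP G; have [m hm] := minimal_form_exists G B.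
rewrite (periodic_invariantE BL.1 hm) ler_pdivlMr// ler_pdivrMr//.
rewrite -natrM ler_nat (flux_class_supp_ge BL hm.1).
by have := minimal_form_supp_le hm; rewrite -(ler_int rat) intrM.
Qed.

(** Each oriented edge of a one-vertex graph is a cycle, so a form with the
    fluxes of kappa agrees with kappa on every edge. *)
Lemma periodic_invariant_bouquet B : #|fvert H| = 1%N -> B \in unitmx ->
  periodic_invariant G = #|supp (kappa (G := G) B)|%:R / 2.
Proof.
move=> V1 Bu; have [m hm] := minimal_form_exists G B.
rewrite (periodic_invariantE Bu hm); congr (_%:R / _); apply: eq_card => e.
have [m1 mF] := hm.1.
have ce : is_cycle [:: e].
  by rewrite /is_cycle /= andbT; apply/eqP; exact: (fintype.card_le1_eqP (eq_leq V1)).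
have := mF _ (cycle_space_cycle ce).
rewrite !flux_chain//; last exact: kappa_one_form.
by rewrite !big_seq1 !inE => ->.
Qed.

End Fundamental.

(** * Periodic graphs on the integer line *)

Lemma walk_cat (R : realType) (d : nat) (G : egraph R d)
    (p q : seq (Defs.arc G)) u v w :
  walk u p v -> walk v q w -> walk u (p ++ q) w.
Proof.
elim: p u => [u ->//|e p IH] u /= [eu] ep vq; split=> //.
exact: IH ep vq.
Qed.

Section IntegerLine.
Context (R : realType) (J : finType) (jump : J -> int) (j1 : J)
  (jump1 : jump j1 = 1).

Definition pt (n : int) : 'rV[R]_1 := const_mx n%:~R.

Lemma ptD m n : pt (m + n) = pt m + pt n.
Proof. by apply/rowP => i; rewrite !mxE intrD. Qed.

(** Translations of arcs must be defined for all vectors; the floor extends the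
    inverse of [pt] beyond the integer points. *)
Definition ptinv (x : 'rV[R]_1) : int := Num.floor (x 0 0).

Lemma ptK : cancel pt ptinv.
Proof. by move=> n; rewrite /ptinv mxE intrKfloor. Qed.

Lemma pt_inj : injective pt.
Proof. exact: can_inj ptK. Qed.

(** The arc (m, j, false) is the j-th edge going from m to m + jump j, and
    (m, j, true) is its reverse, which starts at m + jump j. *)
Definition line_arc : Type := int * J * bool.

Definition line_src (e : line_arc) : 'rV[R]_1 :=
  pt (e.1.1 + if e.2 then jump e.1.2 else 0).

Definition line_rev (e : line_arc) : line_arc := (e.1, ~~ e.2).

Definition line_graph : egraph R 1.
Proof.
refine (@EGraph R 1 (range pt) line_arc line_src line_rev _ _ _).
- by move=> e; exists (e.1.1 + if e.2 then jump e.1.2 else 0).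
- by move=> [e o]; rewrite /line_rev /= negbK.
- by move=> [e []].
Defined.

Definition line_trans (a : 'rV[R]_1) (e : line_arc) : line_arc :=
  (ptinv a + e.1.1, e.1.2, e.2).

Lemma line_lattice_basis : lattice_basis (range pt) 1%:M.
Proof.
split; first exact: unitmx1.
apply/seteqP; split=> [_ [n _ <-]|_ [v _ <-]].
  by exists (const_mx n) => //; rewrite mulmx1; apply/rowP => i; rewrite !mxE.
by exists (v 0 0) => //; rewrite mulmx1; apply/rowP => i; rewrite !mxE !ord1.
Qed.

(** The unit steps of the edges labelled j1 already join all integer points. *)
Lemma line_connected : connected_graph line_graph.
Proof.
move=> _ _ [m _ <-] [n _ <-].
have up (k : nat) m' :
    exists p : seq (Defs.arc line_graph), walk (pt m') p (pt (m' + k%:Z)).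
  elim: k => [|k [p hp]]; first by exists [::]; rewrite addr0.
  exists (p ++ [:: (m' + k%:Z, j1, false)]); apply: walk_cat hp _ => /=.
  by rewrite /tgt /= /line_src /= addr0 jump1 -addrA -[k.+1]addn1 PoszD.
have down (k : nat) m' :
    exists p : seq (Defs.arc line_graph), walk (pt (m' + k%:Z)) p (pt m').
  elim: k => [|k [p hp]]; first by exists [::]; rewrite addr0.
  exists ((m' + k%:Z, j1, true) :: p) => /=; split; last first.
    by rewrite /tgt /= /line_src /= addr0.
  by rewrite /line_src /= jump1 -addrA -[k.+1]addn1 PoszD.
have [mn|/ltW nm] := leP m n.
  by have [p] := up `|n - m|%N m; rewrite gez0_abs ?subr_ge0// subrKC; exists p.
by have [p] := down `|m - n|%N n; rewrite gez0_abs ?subr_ge0// subrKC; exists p.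
Qed.

Definition line_periodic : periodic_graph R 1.
Proof.
refine (@PeriodicGraph R 1 line_graph (range pt) _ line_trans _ _ _ _ _ _ _ _ _ _).
- by exists 1%:M; exact: line_lattice_basis.
- by move=> _ _ [m _ <-] [n _ <-]; exists (n + m) => //; rewrite ptD.
- by move=> [[m j] o]; rewrite /line_trans /ptinv mxE floor0 add0r.
- by move=> _ _ [[m j] o] [a _ <-] [b _ <-]; rewrite /line_trans -ptD !ptK addrA.
- by move=> _ [[m j] o] [a _ <-]; rewrite /= /line_src /= ptK -ptD [in RHS]addrC addrA.
- by [].
- exact: line_connected.
- move=> /(finite_image (fun x => `|ptinv x|%N)); apply: contra_not infinite_nat.
  apply: sub_finite_set => k _; exists (pt k); first by exists k%:Z.
  by rewrite ptK.
- move=> _ [n _ <-].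
  apply: (@sub_finite_set _ _ ((fun x : J * bool =>
    (n - (if x.2 then jump x.1 else 0), x.1, x.2)) @` setT)%classic).
    move=> [[m j] o] /= /pt_inj <-; exists (j, o) => //=; congr (_, _, _).
    exact: addrK.
  exact: finite_image.
- apply: (@sub_finite_set _ _ [set range pt]%classic); last exact: finite_set1.
  move=> _ [_ [n _ <-] <-] /=; apply/seteqP; split=> [_ [_ [m _ <-] <-]|_ [m _ <-]].
    by exists (n + m) => //; rewrite ptD.
  exists (pt (m - n)); first by exists (m - n).
  by rewrite -ptD subrKC.
- apply: (@sub_finite_set _ _ ((fun x : J * bool =>
    [set line_trans a (0, x.1, x.2) | a in range pt]) @` setT)%classic); last exact: finite_image.
  move=> _ [[[n j] o] _ <-]; exists (j, o) => //=; apply/seteqP; split=> _ [_ [m _ <-] <-].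
    exists (pt (m - n)); first by exists (m - n).
    by rewrite /line_trans /= !ptK addr0 subrK.
  exists (pt (m + n)); first by exists (m + n).
  by rewrite /line_trans /= !ptK addr0.
Defined.

Lemma card_line_vert : #|fvert (fundamental_graph line_periodic)| = 1%N.
Proof.
apply/eqP; rewrite eqn_leq; have [-> _] := fundamental_connected line_periodic.
rewrite andbT; apply/fintype.card_le1_eqP => x y _ _.
have [u [Vu <-]] := vproj_surj x; have [v [Vv <-]] := vproj_surj y.
apply/vproj_eqP; have [m _ <-] := Vu; have [n _ <-] := Vv.
by exists (m - n) => //; apply/eqP; rewrite eq_sym subr_eq -ptD subrK.
Qed.

(** The translates of the arcs based at 0 exhaust the arcs, one orbit for each
    label and orientation. *)
Definition line_class (x : J * bool) : farc (fundamental_graph line_periodic) :=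
  aproj (G := line_periodic) (0, x.1, x.2).

Lemma line_class_inj : injective line_class.
Proof. by move=> [i o] [j p] /aproj_eqP[a _ [_ -> ->]]. Qed.

Lemma line_class_surj y : exists x, y = line_class x.
Proof.
have [[[n j] o] <-] := aproj_surj y; exists (j, o); apply/esym/aproj_eqP.
exists (pt n); first by exists n.
by rewrite /= /line_trans /= ptK addr0.
Qed.

Lemma betti_line : betti (fundamental_graph line_periodic) = #|J|%:Z.
Proof.
rewrite /betti card_line_vert subrK; congr Posz.
apply/eqP; rewrite -(eqn_pmul2r (isT : 0 < 2)%N) -card_farc.
rewrite -[in X in _ == X]card_bool -card_prod -(card_imset _ line_class_inj) -cardsT.
by apply/eqP/eq_card => y; have [x ->] := line_class_surj y; rewrite inE imset_f.
Qed.

Lemma periodic_invariant_line :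
  periodic_invariant line_periodic = #|[set j | jump j != 0]%SET|%:R.
Proof.
rewrite (periodic_invariant_bouquet card_line_vert (unitmx1 _ _)).
suff -> : #|supp (kappa (G := line_periodic) 1%:M)| =
    (#|[set j | jump j != 0]%SET| * 2)%N.
  by rewrite natrM mulfK.
rewrite -[in RHS]card_bool -[X in (_ * X)%N]cardsT -cardsX.
rewrite -(card_imset _ line_class_inj); apply: eq_card => y.
have [[j o] ->] := line_class_surj y; rewrite (mem_imset _ _ line_class_inj).
rewrite finset.in_setX !inE andbT; congr (~~ _); rewrite kappaE /coords invmx1 !mulmx1.
rewrite subr_eq0 /tgt /= /line_src /= !add0r (inj_eq pt_inj).
by case: o => //=; rewrite eq_sym.
Qed.

End IntegerLine.

(** The labels of the first summand are parallel edges between neighbours,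
    those of the second are loops. *)
Lemma exists_periodic_graph (R : realType) (k n : nat) :
  exists G : periodic_graph R 1,
  periodic_invariant G = k.+1%:R /\ betti (fundamental_graph G) = (k.+1 + n)%:Z.
Proof.
pose J : finType := ('I_k.+1 + 'I_n)%type.
pose jump (j : J) : int := if j is inl _ then 1 else 0.
have jump1 : jump (inl ord0) = 1 by [].
exists (line_periodic R jump1); split; last first.
  by rewrite betti_line card_sum !card_ord.
rewrite periodic_invariant_line; congr _%:R.
rewrite -[RHS]card_ord -cardsT -(card_imset _ (@inl_inj 'I_k.+1 'I_n)).
apply: eq_card => -[i|i]; rewrite inE /=.
  by rewrite imset_f.
by apply/esym/imsetP => -[].
Qed.

Theorem proposition2p2 (R : realType) :
  (forall (d : nat) (G : periodic_graph R d),
     (forall (B : 'M[R]_d) (m : farc (fundamental_graph G) -> 'rV[R]_d),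
        lattice_basis (lat G) B -> minimal_form B m ->
        periodic_invariant G = #|supp m|%:R / 2) /\
     d%:R <= periodic_invariant G <= (betti (fundamental_graph G))%:~R) /\
  (exists (d : nat) (G : periodic_graph R d),
     d%:R = periodic_invariant G /\
     periodic_invariant G = (betti (fundamental_graph G))%:~R) /\
  (exists (d : nat) (G : periodic_graph R d),
     d%:R = periodic_invariant G /\
     periodic_invariant G < (betti (fundamental_graph G))%:~R) /\
  (exists (d : nat) (G : periodic_graph R d),
     d%:R < periodic_invariant G /\
     periodic_invariant G = (betti (fundamental_graph G))%:~R) /\
  (exists (d : nat) (G : periodic_graph R d),
     d%:R < periodic_invariant G /\
     periodic_invariant G < (betti (fundamental_graph G))%:~R) /\
  (forall n : nat, exists (d : nat) (G : periodic_graph R d),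
     (betti (fundamental_graph G))%:~R - periodic_invariant G = n%:R).
Proof.
split.
  move=> d G; split; last exact: periodic_invariant_bounds.
  by move=> B m [Bu _]; exact: periodic_invariantE.
split.
  by have [G [I b]] := exists_periodic_graph R 0 0; exists 1, G; rewrite I b.
split.
  by have [G [I b]] := exists_periodic_graph R 0 1; exists 1, G; rewrite I b.
split.
  by have [G [I b]] := exists_periodic_graph R 1 0; exists 1, G; rewrite I b.
split.
  by have [G [I b]] := exists_periodic_graph R 1 1; exists 1, G; rewrite I b.
move=> n; have [G [I b]] := exists_periodic_graph R 0 n; exists 1, G.
by rewrite I b PoszD intrD addrC addKr.
Qed.
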